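(* Let $\mathbb{X}=\{a,b,c\}$ (three distinct states), with $\mathbb{P}_a(X_1=c)=0$ and $\mathbb{P}_x(X_1=y)>0$ for all $(x,y)\in\mathbb{X}\times\mathbb{X}$ with $(x,y)\ne(a,c)$. Given $M>0$, define the payoff functions by $$\begin{aligned} f_1(a)&=1,& g_1(a)&=M^2,& f_2(a)&=M,& g_2(a)&=M+1,\\ f_1(b)&=M,& g_1(b)&=M+1,& f_2(b)&=1,& g_2(b)&=2,\\ f_1(c)&=1,& g_1(c)&=2,& f_2(c)&=M^2,& g_2(c)&=M^2+1, \end{aligned}$$ and $h_i(x)=\tfrac12(f_i(x)+g_i(x))$ for all $x\in\mathbb{X}$ and $i\in\{1,2\}$. Then, for all $M>0$ large enough (with the transition probabilities and the discount functions $\delta_1,\delta_2$ fixed), the condition ''for each $i\in\{1,2\}$, $(\delta_i(t)g_i(X_t^x))_{t\ge0}$ is a supermartingale for all $x\in\mathbb{X}$'' is violated, and there exists no soft inter-personal equilibrium.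
   Context: Setting (nonzero-sum Dynkin game). $\mathbb{Z}_+=\{0,1,2,\dots\}$. $X=(X_t)_{t\in\mathbb{Z}_+}$ is a time-homogeneous Markov chain with values in $\mathbb{X}$ (here finite, with $\mathcal{B}=2^{\mathbb{X}}$), on the path space of functions $\mathbb{Z}_+\to\mathbb{X}$; $(\mathcal{F}_t)$ is the filtration generated by $X$, $\mathcal{T}$ is the set of $(\mathcal{F}_t)$-stopping times (allowed to take the value $+\infty$), $X^x$ is the process $X$ with $X_0=x$, $\mathbb{P}_x$ is its law, and $\mathbb{E}_x$ the corresponding expectation. For $i\in\{1,2\}$, the discount function $\delta_i:\mathbb{Z}_+\to[0,1]$ is strictly decreasing with $\delta_i(0)=1$ and $\delta_i(s)\delta_i(t)\le\delta_i(s+t)$ for all $s,t\in\mathbb{Z}_+$. For payoff functions $f_i,g_i,h_i:\mathbb{X}\to[0,\infty)$ and $\tau,\sigma\in\mathcal{T}$, $$F_i(\tau,\sigma):=\delta_i(\tau)f_i(X_\tau)1_{\{\tau<\sigma\}}+\delta_i(\sigma)g_i(X_\sigma)1_{\{\tau>\sigma\}}+\delta_i(\tau)h_i(X_\tau)1_{\{\tau=\sigma\}},$$ with $F_i(\tau,\sigma):=\limsup_{t\to\infty}\delta_i(t)h_i(X_t)$ on $\{\tau=\sigma=+\infty\}$, and $J_i(x,\tau,\sigma):=\mathbb{E}_x[F_i(\tau,\sigma)]$. Here $\tau$ is Player $i$'s stopping time and $\sigma$ the other player's. Stopping policies are sets $S\in\mathcal{B}$. Put $\rho_S:=\inf\{t\ge0:X_t\in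 S\}$ and $\rho_S^+:=\inf\{t>0:X_t\in S\}$ ($\inf\emptyset=\infty$). Equilibria. For $S,T\in\mathcal{B}$ let $$\Theta_i^T(S):=\{x\in S: J_i(x,0,\rho_T)\ge J_i(x,\rho_S^+,\rho_T)\}\cup\{x\notin S: J_i(x,0,\rho_T)>J_i(x,\rho_S^+,\rho_T)\}.$$ $S$ is an intra-personal equilibrium of Player $i$ with respect to $T$ if $\Theta_i^T(S)=S$; $\mathcal{E}_i^T$ is the set of these. $(S,T)\in\mathcal{B}\times\mathcal{B}$ is a soft inter-personal equilibrium if $S\in\mathcal{E}_1^T$ and $T\in\mathcal{E}_2^S$. *)

(* Defs.v *)
From mathcomp Require Import all_boot all_order all_algebra.
From mathcomp Require Import all_classical all_reals all_analysis.

Set Implicit Arguments.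
Unset Strict Implicit.
Unset Printing Implicit Defensive.

Import Order.TTheory GRing.Theory Num.Theory.

Local Open Scope classical_set_scope.
Local Open Scope ring_scope.

(* Throughout, the state space [X] carries the discrete sigma-algebra 2^X, so
   that every [set X] is a stopping policy. *)

Section path_space.
Context {X : pointedType}.

Definition coordinate_events (I : set nat) : set (set (nat -> X)) :=
  [set A | exists2 t, I t & exists B : set X, A = [set w | B (w t)]].

Definition natural_filtration (t : nat) : set (set (nat -> X)) :=
  <<s coordinate_events [set s | (s <= t)%N] >>.

End path_space.

Definition path_space (X : pointedType) :=
  g_sigma_algebraType (@coordinate_events X setT).

(* [P x] is the law of the chain started at [x]; the form of the Markov property
   below is the one appropriate for a countable state space. The transition
   probabilities are [P x [set w | w 1 = y]]. *)
Definition markov_chain (R : realType) (X : pointedType)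
    (P : X -> probability (path_space X) R) : Prop :=
  (forall x, P x [set w | w 0%N = x] = 1%E) /\
  (forall (x : X) (t : nat) (u : nat -> X) (y : X),
    P x [set w | (forall s, (s <= t)%N -> w s = u s) /\ w t.+1 = y] =
    (P x [set w | forall s, (s <= t)%N -> w s = u s] *
     P (u t) [set w | w 1%N = y])%E).

Definition discount_function (R : realType) (delta : nat -> R) : Prop :=
  [/\ delta 0%N = 1,
      forall t, 0 <= delta t <= 1,
      forall s t, (s < t)%N -> delta t < delta s &
      forall s t, delta s * delta t <= delta (s + t)%N].

Section supermartingale.
Context {d : measure_display} {Omega : measurableType d} {R : realType}.
Variable Pr : probability Omega R.

Definition measurable_wrt (G : set (set Omega)) (Y : Omega -> R) : Prop :=
  forall B : set R, measurable B -> G (Y @^-1` B).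

Definition is_conditional_expectation (G : set (set Omega))
    (Y Z : Omega -> R) : Prop :=
  [/\ measurable_wrt G Z,
      Pr.-integrable setT (EFin \o Z) &
      forall A, G A -> (\int[Pr]_(w in A) (Z w)%:E = \int[Pr]_(w in A) (Y w)%:E)%E].

Definition supermartingale (F : nat -> set (set Omega)) (Y : nat -> Omega -> R)
    : Prop :=
  [/\ forall t, measurable_wrt (F t) (Y t),
      forall t, Pr.-integrable setT (EFin \o Y t) &
      forall s t, (s <= t)%N -> exists2 Z : Omega -> R,
        is_conditional_expectation (F s) (Y t) Z &
        {ae Pr, forall w, Z w <= Y s w}].

End supermartingale.

(* Random times take values in [option nat], with [None] standing for +oo. *)
Section game.
Context {R : realType} {X : pointedType}.

(* The infimum of [{t >= k | w t \in S}]: [hitting_from 0] is rho_S and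
   [hitting_from 1] is rho_S^+. *)
Definition hitting_from (k : nat) (S : set X) (w : path_space X) : option nat :=
  if pselect (exists t, (k <= t)%N && (w t \in S)) is left ex
  then Some (ex_minn ex) else None.

Definition rho (S : set X) := hitting_from 0 S.

Definition rho_plus (S : set X) := hitting_from 1 S.

Variable P : X -> probability (path_space X) R.

Section one_player.
Variables (delta : nat -> R) (f g h : X -> R).

(* [tau] is the player's own stopping time, [sigma] that of the opponent. *)
Definition payoff (tau sigma : path_space X -> option nat) (w : path_space X)
    : \bar R :=
  match tau w, sigma w with
  | Some s, Some t =>
      if (s < t)%N then (delta s * f (w s))%:E
      else if (t < s)%N then (delta t * g (w t))%:E
      else (delta s * h (w s))%:E
  | Some s, None => (delta s * f (w s))%:E
  | None, Some t => (delta t * g (w t))%:E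
  | None, None => limn_esup (fun t => (delta t * h (w t))%:E)
  end.

Definition J (x : X) (tau sigma : path_space X -> option nat) : \bar R :=
  (\int[P x]_w payoff tau sigma w)%E.

Definition Theta (T S : set X) : set X :=
  [set x | S x /\
    (J x (rho_plus S) (rho T) <= J x (fun=> Some 0%N) (rho T))%E] `|`
  [set x | ~ S x /\
    (J x (rho_plus S) (rho T) < J x (fun=> Some 0%N) (rho T))%E].

Definition intra_personal_equilibrium (T S : set X) : Prop := Theta T S = S.

End one_player.

End game.

Inductive player := Player1 | Player2.

Definition soft_inter_personal_equilibrium (R : realType) (X : pointedType)
    (P : X -> probability (path_space X) R) (delta : player -> nat -> R)
    (f g h : player -> X -> R) (S T : set X) : Prop :=
  intra_personal_equilibrium P
    (delta Player1) (f Player1) (g Player1) (h Player1) T S /\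
  intra_personal_equilibrium P
    (delta Player2) (f Player2) (g Player2) (h Player2) S T.

(* Main.v *)
Require Import Defs.
From mathcomp Require Import all_boot all_order all_algebra.
From mathcomp Require Import all_classical all_reals all_analysis.
From mathcomp Require Import measurable_realfun lra zify.

Set Implicit Arguments.
Unset Strict Implicit.
Unset Printing Implicit Defensive.

Import Order.TTheory GRing.Theory Num.Theory.

Local Open Scope classical_set_scope.
Local Open Scope ring_scope.

(** Every comparison in the proof has the shape: a positive constant depending
on the chain and the discount functions, times some power of [M], against a
smaller power of [M].  The constants are collected into one [eps], a lower bound
of the discounted probabilities of the few moves that are used, and of
[1 - delta Player2 1].  For [M >= 3 / eps] the larger power always wins.

The supermartingale condition breaks for Player 1 at [b]: with positive
probability, one move to [a] raises the reward [g] from [M + 1] to [M ^+ 2]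
([not_supermartingale]).

Suppose that [(S, T)] is an equilibrium.  As [h < g], a player never stops
where the opponent does, so [S] and [T] are disjoint ([equilibrium_disjoint]).
Beyond this, two facts about a state [x] outside the opponent's set are used.
If the player stops at [x], then [f x] is at least the discounted reward of any
stopping state reachable in one or two moves, weighted by the probability of
these moves ([equilibrium_stop_ge_step], [equilibrium_stop_ge_two_steps]); if the player continues at [x], then [f x] is
at most [delta 1] times an almost sure bound on the later rewards
([equilibrium_wait_le]).  The best responses then go round in a circle:
- [c] lies in [S] or [T]: otherwise Player 2 would prefer to collect the reward
  [M ^+ 2] at [c] at once, since no later reward exceeds [M ^+ 2 + 1] and waiting
  costs the factor [delta Player2 1 < 1].
- [b] is not in [T]: Player 2 prefers to wait for the reward at [c].
- [a] is not in [T]: otherwise Player 1 continues at [b], hoping for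
  [g Player1 a = M ^+ 2], so that nobody stops at [b]; but then Player 2 prefers
  walking through [b] to [c] over stopping at [a].
- [b] is in [S]: otherwise play from [b] ends almost surely, and Player 1 gets at
  most [2] instead of [M] ([ae_hits]).
- [a] and [c] are not in [S]: Player 1 prefers to wait for the reward at [b].
- Hence [S] is [{b}] and [T] is [{c}].  From [a] the chain cannot jump to [c], so
  Player 1 stops first, at [b], unless play never leaves [a]
  ([ae_no_exit_to]); waiting at [a] thus yields Player 2 less than [M], and
  Player 2 must stop at [a] after all. *)

(** * Bounds on integrals of nonnegative functions *)

Section integral_bounds.
Local Open Scope ereal_scope.
Context {d : measure_display} {Omega : measurableType d} {R : realType}.

(** The integral of a nonnegative function is a supremum over the simple
functions below it, hence monotone without any measurability assumption.  This
spares a proof that the payoff of the game, with its stopping times and its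
limit superior, is measurable. *)
Lemma ge0_le_integral_lower (mu : {measure set Omega -> \bar R})
    (u v : Omega -> \bar R) :
  (forall w, 0 <= u w) -> (forall w, u w <= v w) ->
  \int[mu]_w u w <= \int[mu]_w v w.
Proof.
move=> u0 uv; have v0 w : 0 <= v w by exact: le_trans (u0 w) (uv w).
rewrite !ge0_integralTE//; apply: ereal_sup_le => _ [k /= ku <-].
by exists k => //= w; exact: le_trans (ku w) (uv w).
Qed.

Lemma integral_ge_on (Pr : probability Omega R) (A : set Omega) (v : R)
    (u : Omega -> \bar R) :
  measurable A -> (0 <= v)%R -> (forall w, 0 <= u w) ->
  (forall w, A w -> v%:E <= u w) -> v%:E * Pr A <= \int[Pr]_w u w.
Proof.
move=> mA v0 u0 uv.
have <- : \int[Pr]_w (v * \1_A w)%:E = v%:E * Pr A.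
  under eq_integral do rewrite EFinM.
  rewrite ge0_integralZl//; first by rewrite integral_indic// setIT.
  by apply/measurable_EFinP; exact: measurable_indic.
apply: ge0_le_integral_lower => w.
  by rewrite lee_fin mulr_ge0.
rewrite indicE; have [/[1!inE] Aw|_] := boolP (w \in A); rewrite ?mulr1 ?mulr0//.
exact: uv.
Qed.

Lemma integral_le_ae (Pr : probability Omega R) (v : R)
    (u : Omega -> \bar R) :
  (0 <= v)%R -> (forall w, 0 <= u w) -> {ae Pr, forall w, u w <= v%:E} ->
  \int[Pr]_w u w <= v%:E.
Proof.
move=> v0 u0 [N [mN PN uN]].
(* The value +oo on the null set makes [k] dominate [u] everywhere, while its
   integral is still [v]. *)
pose k w := if w \in N then +oo else v%:E.
have mk : measurable_fun setT k.
  apply: measurable_fun_ifT => //.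
  apply: (measurable_fun_bool true); rewrite setTI.
  rewrite (_ : _ @^-1` _ = N)//.
  by apply/seteqP; split => w; [exact: set_mem|exact: mem_set].
have -> : v%:E = \int[Pr]_w k w.
  rewrite (ae_eq_integral (cst v%:E))//.
    by rewrite integral_cst//= probability_setT ?mule1.
  exists N; split => // w /= /not_implyP[_]; apply: contra_notP => Nw.
  by rewrite /k memNset.
apply: ge0_le_integral_lower => // w.
rewrite /k; case: ifPn => [_|/negP wN]; first by rewrite leey.
by apply: contrapT => nuv; apply: wN; apply/mem_set/uN.
Qed.

End integral_bounds.

(** * Events on the path space and hitting times *)

Section paths.
Context {X : pointedType}.
Implicit Types (S : set X) (w : path_space X).

Lemma measurable_coordinate (t : nat) S :
  measurable ([set w | S (w t)] : set (path_space X)).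
Proof. by apply: sub_sigma_algebra; exists t => //; exists S. Qed.

Lemma measurable_forall_le (t : nat) (Q : nat -> set X) :
  measurable ([set w | forall s, (s <= t)%N -> Q s (w s)] : set (path_space X)).
Proof.
rewrite (_ : [set w | _] = \bigcap_(s in [set s | (s <= t)%N]) [set w | Q s (w s)]).
  by apply: bigcap_measurable => //; [exists 0%N|move=> s _; exact: measurable_coordinate].
by [].
Qed.

Variant hitting_from_spec (k : nat) S w : option nat -> Prop :=
| HittingSome t of (k <= t)%N & S (w t) &
    (forall s, (k <= s < t)%N -> ~ S (w s)) : hitting_from_spec k S w (Some t)
| HittingNone of (forall t, (k <= t)%N -> ~ S (w t)) :
    hitting_from_spec k S w None.

Lemma hitting_fromP k S w : hitting_from_spec k S w (hitting_from k S w).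
Proof.
rewrite /hitting_from; case: pselect => [ex|nex].
  case: ex_minnP => t /andP[kt /set_mem St] tmin; constructor => // s /andP[ks st].
  move=> /mem_set Ss; have := tmin s; rewrite ks Ss => /(_ isT).
  by rewrite leqNgt st.
constructor => t kt St; apply: nex; exists t.
by rewrite kt; exact/mem_set.
Qed.

Lemma hitting_from_Some k S w t : (k <= t)%N -> S (w t) ->
  (forall s, (k <= s < t)%N -> ~ S (w s)) -> hitting_from k S w = Some t.
Proof.
move=> kt St ht; case: hitting_fromP => [s ks Ss hs|/(_ t kt)//].
case: (ltngtP s t) => [st|ts|->//].
  by have := ht s; rewrite ks st => /(_ isT).
by have := hs t; rewrite kt ts => /(_ isT).
Qed.

Lemma hitting_from_None k S w : (forall t, (k <= t)%N -> ~ S (w t)) ->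
  hitting_from k S w = None.
Proof. by move=> h; case: hitting_fromP => // t kt /(h _ kt). Qed.

End paths.

(** * Almost sure behaviour of the Markov chain *)

Section markov.
Import numFieldNormedType.Exports.
Context {R : realType} {X : pointedType}.
Variable P : X -> probability (path_space X) R.
Hypothesis P_markov : markov_chain P.
Implicit Types (u : nat -> X) (A E : set (path_space X)).

Definition trans_prob (x y : X) : R := fine (P x [set w | w 1%N = y]).

Lemma trans_probE x y : P x [set w | w 1%N = y] = (trans_prob x y)%:E.
Proof.
rewrite /trans_prob fineK//; apply: fin_num_measure.
exact: (measurable_coordinate 1 [set y]).
Qed.

Lemma trans_prob_ge0 x y : 0 <= trans_prob x y.
Proof. by rewrite /trans_prob fine_ge0. Qed.

Lemma trans_prob_le1 x y : trans_prob x y <= 1.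
Proof.
rewrite -lee_fin -trans_probE; apply: probability_le1.
exact: (measurable_coordinate 1 [set y]).
Qed.

Lemma ae_start x : {ae P x, forall w, w 0%N = x}.
Proof.
have mx : measurable ([set w | w 0%N = x] : set (path_space X)).
  exact: (measurable_coordinate 0 [set x]).
exists (~` [set w | w 0%N = x]); split => //; first exact: measurableC.
by rewrite probability_setC// (P_markov.1 x) subee.
Qed.

Definition cylinder u (k : nat) : set (path_space X) :=
  [set w | forall s, (s < k)%N -> w s = u s].

Lemma measurable_cylinder u k : measurable (cylinder u k).
Proof.
rewrite (_ : cylinder u k = \bigcap_(s in [set s | (s < k)%N]) [set w | w s = u s])//.
case: k => [|k]; first by rewrite (_ : [set s | _] = set0) ?bigcap_set0//; apply/seteqP; split.
apply: bigcap_measurable => //; first by exists 0%N.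
by move=> s _; exact: (measurable_coordinate s [set u s]).
Qed.

Lemma prob_two_steps x u t y z :
  P x (cylinder u t.+1 `&` [set w | w t.+1 = y /\ w t.+2 = z]) =
  (P x (cylinder u t.+1) * (trans_prob (u t) y * trans_prob y z)%:E)%E.
Proof.
have := P_markov.2 x t u y; rewrite trans_probE => Py.
pose u' s := if s == t.+1 then y else u s.
have := P_markov.2 x t.+1 u' z.
have -> : u' t.+1 = y by rewrite /u' eqxx.
rewrite trans_probE.
have cylE : [set w : path_space X | forall s, (s <= t.+1)%N -> w s = u' s] =
  [set w : path_space X | (forall s, (s <= t)%N -> w s = u s) /\ w t.+1 = y].
  apply/seteqP; split => [w wu|w [wu wy] s st]; rewrite /u' in wu *.
    split => [s st|]; last by rewrite wu// eqxx.
    by rewrite wu; [case: eqVneq => // ?; lia|lia].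
  by case: eqVneq => [->//|/eqP sNt]; apply: wu; lia.
rewrite cylE Py -muleA -EFinM => <-; congr (P x _).
apply/seteqP; split => w.
  move=> [wu [wy wz]]; split => // s st; rewrite /u'.
  by case: eqVneq => [->//|/eqP sNt]; apply: wu; rewrite ltnS; lia.
move=> [wu wz]; split.
  by move=> s st; rewrite wu /u'; [case: eqVneq => // ?; lia|lia].
by split => //; rewrite wu// /u' eqxx.
Qed.

(** The path is at [x] just before it leaves [x] for the first time, so the
exit can only be to a state that is a possible successor of [x]. *)
Lemma ae_no_exit_to x z : trans_prob x z = 0 ->
  {ae P x, forall w t, (forall s, (s <= t)%N -> w s = x) -> w t.+1 <> z}.
Proof.
move=> xz0.
pose F t := [set w : path_space X | (forall s, (s <= t)%N -> w s = x) /\ w t.+1 = z].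
have F0 t : (P x).-negligible (F t).
  apply/negligibleP.
    apply: measurableI; first exact: (measurable_forall_le t (fun=> [set x])).
    exact: (measurable_coordinate t.+1 [set z]).
  by have := P_markov.2 x t (fun=> x) z; rewrite trans_probE xz0 mule0.
apply: negligibleS (negligible_bigcup F0) => w /= /existsNP[t].
by move=> /not_implyP[wx /contrapT wz]; exists t.
Qed.

(** Measurability with respect to the past up to time [t], in the form that can
be tested against a single path of each cylinder. *)
Definition determined (t : nat) A := forall w w' : path_space X,
  (forall s, (s <= t)%N -> w s = w' s) -> A w -> A w'.

Hypothesis X_fin : finite_set [set: X].

Lemma total_probability x k A : measurable A ->
  P x A = (\sum_(y \in [set: X]) P x (A `&` [set w | w k = y]))%E.
Proof.
move=> mA; rewrite -measure_fin_bigcup//.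
- congr (P x _); apply/seteqP; split => [w Aw|w [y _ []]//].
  by exists (w k).
- by move=> y y' _ _ [w [[_ /= <-] [_ /= <-]]].
- move=> y _; apply: measurableI => //.
  exact: (measurable_coordinate k [set y]).
Qed.

(** The Markov property is given on cylinders.  An event of the past is a finite
disjoint union of cylinders, so an estimate that is linear in the conditioning
event passes from cylinders to all events of the past. *)
Lemma prob_past_ge x t (kappa : R) A E : 0 <= kappa ->
  measurable A -> measurable E -> determined t A ->
  (forall u, kappa%:E * P x (cylinder u t.+1) <=
     P x (cylinder u t.+1 `&` E))%E ->
  (kappa%:E * P x A <= P x (A `&` E))%E.
Proof.
move=> kappa0 mA mE dA PE.
(* Induction on the number [n] of past coordinates that are not yet fixed; the
   law of total probability releases one coordinate at a time. *)
suff claim n u : (n <= t.+1)%N ->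
    (kappa%:E * P x (A `&` cylinder u (t.+1 - n)) <=
     P x (A `&` cylinder u (t.+1 - n) `&` E))%E.
  have := claim t.+1 (fun=> x) (leqnn _); rewrite subnn.
  suff -> : cylinder (fun=> x) 0 = setT by rewrite setIT.
  by apply/seteqP; split.
elim: n u => [|n IH] u nt.
  rewrite subn0; have [[w [Aw wu]]|A0] := pselect (A `&` cylinder u t.+1 !=set0).
    suff -> : A `&` cylinder u t.+1 = cylinder u t.+1 by exact: PE.
    apply/seteqP; split => [v []//|v vu]; split => //.
    by apply: dA Aw => s st; rewrite wu// vu.
  suff -> : A `&` cylinder u t.+1 = set0 by rewrite set0I measure0 mule0.
  by apply/seteqP; split => // w Aw; apply: A0; exists w.
set k := (t.+1 - n.+1)%N.
have kS : (t.+1 - n = k.+1)%N by rewrite /k; lia.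
have mAu : measurable (A `&` cylinder u k).
  by apply: measurableI => //; exact: measurable_cylinder.
rewrite (total_probability x k mAu).
rewrite (total_probability x k (measurableI _ _ mAu mE)).
rewrite ge0_mule_fsumr//; apply: lee_fsum => // y _.
pose u' s := if s == k then y else u s.
have AE : A `&` cylinder u k `&` [set w | w k = y] = A `&` cylinder u' k.+1.
  apply/seteqP; split => w.
    move=> [[Aw wu] wy]; split => // s; rewrite ltnS /u' => sk.
    by case: eqVneq => [->//|/eqP sNk]; apply: wu; lia.
  move=> [Aw wu]; split; first split => // s sk.
    by rewrite wu /u'; [case: eqVneq => // ?; lia|lia].
  by rewrite /= wu// /u' eqxx.
rewrite (setIAC _ E) AE.
by have := IH u' (ltnW nt); rewrite kS.
Qed.

(** Whatever the past, the next two moves go through [y] to [z] with conditional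
probability at least [kappa]; so the probability of avoiding [z] during [2 n]
moves is at most [(1 - kappa) ^+ n].  Two moves are needed for a target that is
not accessible in one move from every state. *)
Lemma ae_hits x y z (kappa : R) : 0 < kappa ->
  (forall v, kappa <= trans_prob v y * trans_prob y z) ->
  {ae P x, forall w, exists2 t, (0 < t)%N & w t = z}.
Proof.
move=> kappa0 kappa_le.
have kappa1 : 0 <= 1 - kappa.
  rewrite subr_ge0 (le_trans (kappa_le x))//.
  by rewrite mulr_ile1 ?trans_prob_ge0 ?trans_prob_le1.
(* The case distinction exempts time 0, where the path may start at [z]. *)
pose avoid n : set (path_space X) :=
  [set w | forall s, (s <= n)%N -> (if s is 0 then setT else [set~ z]) (w s)].
have m_avoid n : measurable (avoid n).
  exact: (measurable_forall_le n (fun s => if s is 0 then setT else [set~ z])).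
pose q n := fine (P x (avoid n)).
have qE n : P x (avoid n) = (q n)%:E by rewrite fineK// fin_num_measure.
have q_step n : q n.+2 <= (1 - kappa) * q n.
  pose E := [set w : path_space X | w n.+1 = y /\ w n.+2 = z].
  have mE : measurable E.
    apply: measurableI.
      exact: (measurable_coordinate n.+1 [set y]).
    exact: (measurable_coordinate n.+2 [set z]).
  have kq : (kappa%:E * P x (avoid n) <= P x (avoid n `&` E))%E.
    apply: (@prob_past_ge x n) => //; first exact: ltW.
      by move=> w w' ww' wn s sn; rewrite -ww'//; exact: wn.
    move=> u; rewrite prob_two_steps muleC.
    by apply: lee_pmul => //; rewrite ?lee_fin// ltW.
  have mAE := measurableI _ _ (m_avoid n) mE.
  have : (P x (avoid n.+2) + P x (avoid n `&` E) <= P x (avoid n))%E.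
    rewrite -measureU//; last first.
      apply/seteqP; split => // w [/(_ n.+2 (leqnn _)) /= wz [_ [_ ?]]]//.
    apply: le_measure; rewrite ?inE//; first exact: measurableU.
    move=> w [wn|[]//] s sn; apply: wn; lia.
  move: kq; rewrite !qE -EFinM.
  have : P x (avoid n `&` E) \is a fin_num by exact: fin_num_measure.
  move=> /fineK <-; rewrite -EFinD !lee_fin; lra.
have q_pow n : q n.*2 <= (1 - kappa) ^+ n.
  elim: n => [|n IH].
    by rewrite expr0 -lee_fin -qE probability_le1.
  rewrite doubleS exprS; apply: le_trans (q_step _) _.
  exact: ler_wpM2l.
have mN : measurable (\bigcap_n avoid n) by exact: bigcapT_measurable.
exists (\bigcap_n avoid n); split => //.
  apply/eqP; rewrite eq_le measure_ge0 andbT.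
  have /fineK qN : P x (\bigcap_n avoid n) \is a fin_num by exact: fin_num_measure.
  rewrite -qN lee_fin.
  have cvg0 : ((1 - kappa) ^+ n @[n --> \oo] --> (0 : R)).
    by apply: cvg_expr; rewrite ger0_norm// ltrBlDr ltrDl.
  apply: (ler_cvg_to (cvg_cst _) cvg0); apply: nearW => n /=.
  rewrite (le_trans _ (q_pow n))// -lee_fin -qE qN.
  by apply: le_measure; rewrite ?inE// => w; apply.
move=> w /= nhit n _ [//|s] sn wz; apply: nhit.
by exists s.+1.
Qed.

End markov.

(** * Payoff of waiting along a path *)

Section payoffs.
Context {R : realType} {X : pointedType}.
Variables (delta : nat -> R) (f g h : X -> R).
Hypothesis delta_discount : discount_function delta.
Hypotheses (f_ge0 : forall x, 0 <= f x) (g_ge0 : forall x, 0 <= g x)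
  (h_ge0 : forall x, 0 <= h x).
Implicit Types (S T : set X) (w : path_space X)
  (tau sigma : path_space X -> option nat).

Lemma discount_ge0 t : 0 <= delta t.
Proof. by case: delta_discount => _ /(_ t)/andP[]. Qed.

Lemma discount_gt0 t : 0 < delta t.
Proof.
case: delta_discount => _ _ dec _.
exact: le_lt_trans (discount_ge0 t.+1) (dec t t.+1 (ltnSn t)).
Qed.

Lemma discount1_lt1 : delta 1%N < 1.
Proof. by case: delta_discount => <- _ dec _; exact: dec. Qed.

Lemma discount_le1 t : (0 < t)%N -> delta t <= delta 1%N.
Proof.
case: delta_discount => _ _ dec _; case: t => [//|[//|t]] _.
by apply/ltW/dec.
Qed.

Lemma payoff_ge0 tau sigma w : (0 <= payoff delta f g h tau sigma w)%E.
Proof.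
have d0 := discount_ge0; rewrite /payoff.
case: (tau w) => [s|]; case: (sigma w) => [t|]; rewrite ?lee_fin ?mulr_ge0//.
  by case: ifP => _; [|case: ifP => _]; rewrite lee_fin mulr_ge0.
apply: limf_esup_ge0 => [|t]; last by rewrite lee_fin mulr_ge0.
exact: filter_not_empty.
Qed.

Lemma limn_esup_le (u : nat -> \bar R) (v : \bar R) k :
  (forall t, (k <= t)%N -> (u t <= v)%E) -> (limn_esup u <= v)%E.
Proof.
move=> uv; rewrite /limn_esup limf_esupE.
apply: (@le_trans _ _ (ereal_sup (u @` [set t | (k <= t)%N]))).
  apply: ereal_inf_lbound; exists [set t | (k <= t)%N] => //.
  exact: nbhs_infty_ge.
by apply: ge_ereal_sup => _ [t kt <-]; exact: uv.
Qed.

(** For disjoint stopping sets, and an opponent that does not stop at time 0, the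
payoff of waiting is decided at the first time [t > 0] at which the path visits
[S `|` T]: the set that is visited tells who stops. *)
Section waiting.
Variables S T : set X.
Hypothesis ST0 : S `&` T = set0.

Let disjoint x : S x -> T x -> False.
Proof. by move=> Sx Tx; have : (S `&` T) x by []; rewrite ST0. Qed.

Local Notation wait := (payoff delta f g h (rho_plus S) (rho T)).

Lemma payoff_own_stop w t : ~ T (w 0%N) -> (0 < t)%N ->
  (forall s, (0 < s < t)%N -> ~ (S `|` T) (w s)) -> S (w t) ->
  wait w = (delta t * f (w t))%:E.
Proof.
move=> T0 t0 before St; rewrite /payoff /rho_plus (@hitting_from_Some _ _ _ _ t)//.
  rewrite /rho; case: hitting_fromP => [t' _ Tt' _|//].
  case: (ltngtP t t') => [//|t't|tt']; last by case: (disjoint St); rewrite tt'.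
  case: t' t't Tt' => [|t'] t't Tt'; first by case: T0.
  by case: (before t'.+1); [|right].
by move=> s /before; apply: contra_not; left.
Qed.

Lemma payoff_other_stop w t : ~ T (w 0%N) -> (0 < t)%N ->
  (forall s, (0 < s < t)%N -> ~ (S `|` T) (w s)) -> T (w t) ->
  wait w = (delta t * g (w t))%:E.
Proof.
move=> T0 t0 before Tt; rewrite /payoff /rho (@hitting_from_Some _ _ _ _ t)//.
  rewrite /rho_plus; case: hitting_fromP => [t' t'0 St' _|//].
  case: (ltngtP t t') => [tt'|t't|tt'].
  - by [].
  - by case: (before t'); [rewrite t'0|left].
  - by case: (disjoint St'); rewrite -tt'.
move=> [|s] st; first by [].
by move=> Ts; case: (before s.+1); [|right].
Qed.

Lemma payoff_never_stop w : ~ T (w 0%N) ->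
  (forall s, (0 < s)%N -> ~ (S `|` T) (w s)) ->
  wait w = limn_esup (fun t => (delta t * h (w t))%:E).
Proof.
move=> T0 never; rewrite /payoff /rho_plus hitting_from_None; last first.
  by move=> s /never; apply: contra_not; left.
rewrite /rho hitting_from_None// => -[//|s] _ Ts.
by case: (never s.+1); [|right].
Qed.

Lemma payoff_wait_le w (v : R) : ~ T (w 0%N) ->
  (forall t, (0 < t)%N -> (forall s, (0 < s < t)%N -> ~ (S `|` T) (w s)) ->
     (S (w t) -> f (w t) <= v) /\ (T (w t) -> g (w t) <= v)) ->
  ((forall s, (0 < s)%N -> ~ (S `|` T) (w s)) ->
     forall t, (0 < t)%N -> h (w t) <= v) ->
  (wait w <= (delta 1%N * v)%:E)%E.
Proof.
move=> T0 stop_le never_le.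
have discounted t y : (0 < t)%N -> 0 <= y -> y <= v ->
    (delta t * y <= delta 1%N * v).
  by move=> t0 y0 yv; apply: ler_pM => //; [exact: discount_ge0|exact: discount_le1].
case: (hitting_fromP 1 (S `|` T) w) => [t t0 STt before|never].
  have [fv gv] := stop_le t t0 before.
  case: STt => [St|Tt].
    by rewrite (@payoff_own_stop w t)// lee_fin discounted// fv.
  by rewrite (@payoff_other_stop w t)// lee_fin discounted// gv.
rewrite payoff_never_stop//; apply: (@limn_esup_le _ _ 1) => t t0.
by rewrite lee_fin discounted// never_le.
Qed.

End waiting.

End payoffs.

(** * Expected payoffs and intra-personal equilibria *)

Section equilibria.
Context {R : realType} {X : pointedType}.
Variable P : X -> probability (path_space X) R.
Hypothesis P_markov : markov_chain P.
Variables (delta : nat -> R) (f g h : X -> R).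
Hypothesis delta_discount : discount_function delta.
Hypotheses (f_ge0 : forall x, 0 <= f x) (g_ge0 : forall x, 0 <= g x)
  (h_ge0 : forall x, 0 <= h x).
Implicit Types (S T : set X) (w : path_space X)
  (tau sigma : path_space X -> option nat).

Local Notation payoff := (payoff delta f g h).
Local Notation J := (J P delta f g h).
Local Notation trans_prob := (trans_prob P).

Lemma J_ge x A (v : R) tau sigma : measurable A -> 0 <= v ->
  (forall w, w 0%N = x -> A w -> (v%:E <= payoff tau sigma w)%E) ->
  (v%:E * P x A <= J x tau sigma)%E.
Proof.
move=> mA v0 vJ.
have mx : measurable ([set w | w 0%N = x] : set (path_space X)).
  exact: (measurable_coordinate 0 [set x]).
have mAx := measurableI _ _ mA mx.
have PAx : (P x A <= P x (A `&` [set w | w 0%N = x]))%E.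
  have Px0 : P x (~` [set w | w 0%N = x]) = 0%E.
    by rewrite probability_setC// (P_markov.1 x) subee.
  rewrite -(measureU0 mAx (measurableC mx) Px0).
  apply: le_measure; rewrite ?inE//.
    by apply: measurableU => //; exact: measurableC.
  by move=> w Aw; have [wx|wx] := pselect (w 0%N = x); [left|right].
apply: (le_trans (lee_pmul _ _ (lexx _) PAx)); rewrite ?lee_fin//.
apply: integral_ge_on => //; first by move=> w; exact: payoff_ge0.
by move=> w [Aw wx]; exact: vJ.
Qed.

Lemma J_le x (v : R) tau sigma : 0 <= v ->
  {ae P x, forall w, w 0%N = x -> (payoff tau sigma w <= v%:E)%E} ->
  (J x tau sigma <= v%:E)%E.
Proof.
move=> v0 Jv; apply: integral_le_ae => //.
  by move=> w; exact: payoff_ge0.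
have FF := ae_filter_ringOfSetsType (P x).
apply: (filterS2 _ _ (ae_start P_markov x) Jv) => w wx; exact.
Qed.

Lemma J_eq x (v : R) tau sigma : 0 <= v ->
  (forall w, w 0%N = x -> payoff tau sigma w = v%:E) -> J x tau sigma = v%:E.
Proof.
move=> v0 Jv; apply/eqP; rewrite eq_le; apply/andP; split.
  by apply: J_le => //; apply: aeW => w /Jv ->.
rewrite -[leLHS]mule1 -(@probability_setT _ _ _ (P x)).
by apply: J_ge => // w /Jv ->.
Qed.

Let delta0 : delta 0%N = 1. Proof. by case: delta_discount. Qed.

Lemma J_stop_now x T : ~ T x -> J x (fun=> Some 0%N) (rho T) = (f x)%:E.
Proof.
move=> Tx; apply: J_eq => // w wx; rewrite /Defs.payoff /rho.
case: hitting_fromP => [[|t] _ Tt _|_]; rewrite ?delta0 ?mul1r wx//.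
by case: Tx; rewrite -wx.
Qed.

Lemma J_stop_together x T : T x -> J x (fun=> Some 0%N) (rho T) = (h x)%:E.
Proof.
move=> Tx; apply: J_eq => // w wx.
rewrite /Defs.payoff /rho (@hitting_from_Some _ _ _ _ 0) ?wx//.
by rewrite ltnn delta0 mul1r.
Qed.

Lemma J_other_stops x S T : T x -> J x (rho_plus S) (rho T) = (g x)%:E.
Proof.
move=> Tx; apply: J_eq => // w wx.
rewrite /Defs.payoff /rho (@hitting_from_Some _ _ _ _ 0) ?wx//.
rewrite /rho_plus; case: hitting_fromP => [[//|t] _ _ _|_];
  by rewrite ?ltn0 ?ltn0Sn delta0 mul1r.
Qed.

Section waiting.
Variables S T : set X.
Hypothesis ST0 : S `&` T = set0.

Local Notation W x := (J x (rho_plus S) (rho T)).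

Lemma wait_ge_step x y (v : R) : ~ T x -> 0 <= v -> (S `|` T) y ->
  (S y -> v <= f y) -> (T y -> v <= g y) ->
  ((delta 1%N * v * trans_prob x y)%:E <= W x)%E.
Proof.
move=> Tx v0 STy vf vg.
have d0 := discount_ge0 delta_discount.
rewrite EFinM -trans_probE; apply: J_ge.
- exact: (measurable_coordinate 1 [set y]).
- exact: mulr_ge0.
move=> w wx /= wy.
have before s : (0 < s < 1)%N -> ~ (S `|` T) (w s) by case: s.
case: STy => [Sy|Ty].
  rewrite (payoff_own_stop _ _ _ _ ST0 (t := 1)) ?wx ?wy//.
  by rewrite lee_fin ler_wpM2l// vf.
rewrite (payoff_other_stop _ _ _ _ ST0 (t := 1)) ?wx ?wy//.
by rewrite lee_fin ler_wpM2l// vg.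
Qed.

Lemma wait_ge_two_steps x y z (v : R) : ~ T x -> 0 <= v -> ~ (S `|` T) y ->
  (S `|` T) z -> (S z -> v <= f z) -> (T z -> v <= g z) ->
  ((delta 2%N * v * (trans_prob x y * trans_prob y z))%:E <= W x)%E.
Proof.
move=> Tx v0 STy STz vf vg.
have d0 := discount_ge0 delta_discount.
have := prob_two_steps P_markov x (fun=> x) 0 y z.
have -> : cylinder (fun=> x) 1 = [set w | w 0%N = x].
  by apply/seteqP; split => [w /(_ 0%N (ltnSn 0))/= ->//|w wx [|]].
rewrite (P_markov.1 x) mul1e (EFinM (delta 2%N * v)) => <-; apply: J_ge.
- apply: measurableI; first exact: (measurable_coordinate 0 [set x]).
  apply: measurableI; first exact: (measurable_coordinate 1 [set y]).
  exact: (measurable_coordinate 2 [set z]).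
- exact: mulr_ge0.
move=> w wx /= [_ [wy wz]].
have before s : (0 < s < 2)%N -> ~ (S `|` T) (w s) by case: s => [|[|]]//; rewrite wy.
case: STz => [Sz|Tz].
  rewrite (payoff_own_stop _ _ _ _ ST0 (t := 2)) ?wx ?wz//.
  by rewrite lee_fin ler_wpM2l// vf.
rewrite (payoff_other_stop _ _ _ _ ST0 (t := 2)) ?wx ?wz//.
by rewrite lee_fin ler_wpM2l// vg.
Qed.

Lemma wait_le x (v : R) : ~ T x -> 0 <= v ->
  {ae P x, forall w, w 0%N = x ->
    (forall t, (0 < t)%N -> (forall s, (0 < s < t)%N -> ~ (S `|` T) (w s)) ->
       (S (w t) -> f (w t) <= v) /\ (T (w t) -> g (w t) <= v)) /\
    ((forall s, (0 < s)%N -> ~ (S `|` T) (w s)) ->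
       forall t, (0 < t)%N -> h (w t) <= v)} ->
  (W x <= (delta 1%N * v)%:E)%E.
Proof.
move=> Tx v0 wv; apply: J_le; first by rewrite mulr_ge0 ?(discount_ge0 delta_discount).
apply: filterS wv => w wv wx; have [stop never] := wv wx.
by apply: payoff_wait_le => //; rewrite wx.
Qed.

End waiting.

Section equilibrium.
Variables S T : set X.
Hypothesis eqS : intra_personal_equilibrium P delta f g h T S.
Hypothesis h_lt_g : forall x, h x < g x.

(** Where the opponent stops, stopping pays [h] and waiting pays [g > h]. *)
Lemma equilibrium_disjoint : S `&` T = set0.
Proof.
apply/seteqP; split => // x [Sx Tx].
have : Theta P delta f g h T S x by rewrite eqS.
case=> [[_]|[/(_ Sx)//]].
by rewrite J_other_stops// J_stop_together// lee_fin leNgt h_lt_g.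
Qed.

Lemma stop_wait_le x : S x -> (J x (rho_plus S) (rho T) <= (f x)%:E)%E.
Proof.
move=> Sx; have Tx : ~ T x.
  by move=> Tx; have : (S `&` T) x by []; rewrite equilibrium_disjoint.
have : Theta P delta f g h T S x by rewrite eqS.
by case=> [[_]|[/(_ Sx)//]]; rewrite J_stop_now.
Qed.

(** On the event that the first move is to [y], play ends at time 1 with a reward
of at least [v]; the other paths contribute a nonnegative amount. *)
Lemma equilibrium_stop_ge_step x y (v : R) : S x -> 0 <= v -> (S `|` T) y ->
  (S y -> v <= f y) -> (T y -> v <= g y) -> delta 1%N * v * trans_prob x y <= f x.
Proof.
move=> Sx v0 STy vf vg; rewrite -lee_fin.
apply: le_trans (stop_wait_le Sx); apply: wait_ge_step => //.
  exact: equilibrium_disjoint.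
by move=> Tx; have : (S `&` T) x by []; rewrite equilibrium_disjoint.
Qed.

Lemma equilibrium_stop_ge_two_steps x y z (v : R) : S x -> 0 <= v ->
  ~ (S `|` T) y -> (S `|` T) z -> (S z -> v <= f z) -> (T z -> v <= g z) ->
  delta 2%N * v * (trans_prob x y * trans_prob y z) <= f x.
Proof.
move=> Sx v0 STy STz vf vg; rewrite -lee_fin.
apply: le_trans (stop_wait_le Sx); apply: wait_ge_two_steps => //.
  exact: equilibrium_disjoint.
by move=> Tx; have : (S `&` T) x by []; rewrite equilibrium_disjoint.
Qed.

Lemma equilibrium_wait_le x (v : R) : ~ S x -> ~ T x -> 0 <= v ->
  {ae P x, forall w, w 0%N = x ->
    (forall t, (0 < t)%N -> (forall s, (0 < s < t)%N -> ~ (S `|` T) (w s)) ->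
       (S (w t) -> f (w t) <= v) /\ (T (w t) -> g (w t) <= v)) /\
    ((forall s, (0 < s)%N -> ~ (S `|` T) (w s)) ->
       forall t, (0 < t)%N -> h (w t) <= v)} ->
  f x <= delta 1%N * v.
Proof.
move=> Sx Tx v0 /(wait_le equilibrium_disjoint Tx v0) Wv.
rewrite -lee_fin; apply: le_trans Wv.
rewrite leNgt -(@J_stop_now _ T)//; apply/negP => stop.
apply: (Sx); suff : Theta P delta f g h T S x by rewrite eqS.
by right; split.
Qed.

End equilibrium.

End equilibria.

(** * Absence of equilibria in the three-state game *)

(** The times 0 and 1 suffice: the contribution of the single successor [y] to the
expectation at time 1 already exceeds the value at time 0. *)
Lemma not_supermartingale (R : realType) (X : pointedType)
    (P : X -> probability (path_space X) R) (delta : nat -> R) (g : X -> R)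
    (x y : X) :
  markov_chain P -> discount_function delta -> (forall x, 0 <= g x) ->
  g x < delta 1%N * g y * trans_prob P x y ->
  ~ supermartingale (P x) natural_filtration (fun t w => delta t * g (w t)).
Proof.
move=> P_markov D g0 gxy [_ _ /(_ 0%N 1%N isT)[Z [_ Zint ZY] Zle]].
have delta0 : delta 0%N = 1 by case: D.
have FT : @natural_filtration X 0 setT.
  by rewrite -(setD0 setT); apply: sigma_algebraCD; exact: sigma_algebra0.
have Zle_gx : (\int[P x]_w (Z w)%:E <= (g x)%:E)%E.
  rewrite integralE; apply: (@le_trans _ _ (\int[P x]_w ((EFin \o Z)^\+ w))%E).
    by rewrite geeDl// oppe_le0 integral_ge0.
  apply: integral_le_ae => //.
  have FF := ae_filter_ringOfSetsType (P x).
  apply: (filterS2 _ _ (ae_start P_markov x) Zle) => w wx.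
  by rewrite delta0 mul1r wx => Zw; rewrite funeposE /= -EFin_max lee_fin ge_max Zw g0.
have : ((delta 1%N * g y)%:E * P x [set w | w 1%N = y] <=
    \int[P x]_w (delta 1%N * g (w 1%N))%:E)%E.
  have d1 := discount_ge0 D 1; apply: integral_ge_on.
  - exact: (measurable_coordinate 1 [set y]).
  - exact: mulr_ge0.
  - by move=> w; rewrite lee_fin mulr_ge0.
  - by move=> w /= ->.
rewrite -(ZY _ FT) trans_probE => /le_trans/(_ Zle_gx).
by rewrite -EFinM lee_fin leNgt gxy.
Qed.

Theorem proposition4p1 (R : realType) (X : pointedType) (a b c : X)
    (abc_uniq : uniq [:: a; b; c]) (abc_all : forall x : X, x \in [:: a; b; c])
    (P : X -> probability (path_space X) R) (P_markov : markov_chain P)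
    (P_ac : P a [set w | w 1%N = c] = 0%E)
    (P_pos : forall x y : X, (x, y) <> (a, c) ->
       (0 < P x [set w | w 1%N = y])%E)
    (delta : player -> nat -> R)
    (delta_discount : forall i : player, discount_function (delta i)) :
  exists M0 : R, 0 < M0 /\ forall M : R, M0 <= M ->
    forall f g h : player -> X -> R,
      f Player1 a = 1 -> g Player1 a = M ^+ 2 ->
      f Player1 b = M -> g Player1 b = M + 1 ->
      f Player1 c = 1 -> g Player1 c = 2 ->
      f Player2 a = M -> g Player2 a = M + 1 ->
      f Player2 b = 1 -> g Player2 b = 2 ->
      f Player2 c = M ^+ 2 -> g Player2 c = M ^+ 2 + 1 ->
      (forall (i : player) (x : X), h i x = 2^-1 * (f i x + g i x)) ->
      ~ (forall (i : player) (x : X),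
           supermartingale (P x) natural_filtration
             (fun t w => delta i t * g i (w t))) /\
      ~ (exists S T : set X, soft_inter_personal_equilibrium P delta f g h S T).
Proof.
have abcP x : [\/ x = a, x = b | x = c].
  have := abc_all x; rewrite !inE => /or3P[] /eqP ->;
  by [constructor 1|constructor 2|constructor 3].
have [aNb aNc bNc] : [/\ a <> b, a <> c & b <> c].
  move: abc_uniq; rewrite /= !inE negb_or => /and3P[/andP[/eqP ? /eqP ?] /eqP ? _].
  by split.
have p_gt0 x y : (x, y) <> (a, c) -> 0 < trans_prob P x y.
  by move=> /P_pos; rewrite trans_probE lte_fin.
have p_ba : 0 < trans_prob P b a by apply: p_gt0 => -[].
have p_bc : 0 < trans_prob P b c by apply: p_gt0 => -[] /esym.
have p_ab : 0 < trans_prob P a b by apply: p_gt0 => -[].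
have p_bb : 0 < trans_prob P b b by apply: p_gt0 => -[] /esym.
have p_cb : 0 < trans_prob P c b by apply: p_gt0 => -[] _ /bNc.
have d1 : 0 < delta Player1 1%N by exact: discount_gt0.
have d2 : 0 < delta Player2 1%N by exact: discount_gt0.
have d22 : 0 < delta Player2 2%N by exact: discount_gt0.
have d2_lt1 : delta Player2 1%N < 1 by exact: discount1_lt1.
have [eps [eps_gt0 eps_le1 [eps1 eps2 eps3 eps4] [eps5 eps6]]] :
    exists e : R, [/\ 0 < e, e <= 1,
      [/\ e <= delta Player1 1%N * trans_prob P b a,
          e <= delta Player2 1%N * trans_prob P b c,
          e <= delta Player2 2%N * (trans_prob P a b * trans_prob P b c) &
          e <= delta Player1 1%N * trans_prob P a b] &
      e <= delta Player1 1%N * trans_prob P c b /\ e <= 1 - delta Player2 1%N].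
  exists (\big[Num.min/1]_(v <- [:: delta Player1 1%N * trans_prob P b a;
    delta Player2 1%N * trans_prob P b c;
    delta Player2 2%N * (trans_prob P a b * trans_prob P b c);
    delta Player1 1%N * trans_prob P a b;
    delta Player1 1%N * trans_prob P c b; 1 - delta Player2 1%N]) v).
  rewrite !big_cons big_nil; split; first by rewrite !lt_min !mulr_gt0//= subr_gt0 d2_lt1 ltr01.
  - by rewrite !ge_min lexx !orbT.
  - by split; rewrite !ge_min lexx ?orbT.
  - by split; rewrite !ge_min lexx ?orbT.
(* [M >= 3 / eps] gives [M >= 3], as [eps <= 1], and [eps * M ^+ 2 >= 3 * M], which
   is more than [M + 1]. *)
exists (3 / eps); split; first by rewrite divr_gt0.
move=> M M_ge f g h f1a g1a f1b g1b f1c g1c f2a g2a f2b g2b f2c g2c hE.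
have eM : 3 <= eps * M by rewrite mulrC -ler_pdivrMr.
have M3 : 3 <= M by nra.
have M2 : 3 * M <= eps * M ^+ 2 by nra.
have fg i x : 0 <= f i x /\ f i x < g i x.
  case: i; case: (abcP x) => ->; rewrite ?f1a ?g1a ?f1b ?g1b ?f1c ?g1c
    ?f2a ?g2a ?f2b ?g2b ?f2c ?g2c; split; nra.
have f0 i x : 0 <= f i x by have [] := fg i x.
have g0 i x : 0 <= g i x by have [] := fg i x; lra.
have h0 i x : 0 <= h i x by rewrite hE; have [] := fg i x; lra.
have hg i x : h i x < g i x by rewrite hE; have [] := fg i x; lra.
split.
  move=> /(_ Player1 b); apply: (@not_supermartingale _ _ _ _ _ b a) => //.
  rewrite g1b g1a; nra.
case=> S [T [eqS eqT]].
have FF x := ae_filter_ringOfSetsType (P x).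
have disjoint x : S x -> T x -> False.
  move=> Sx Tx; have : (S `&` T) x by [].
  by rewrite (equilibrium_disjoint P_markov _ _ _ _ eqS).
have stop1 := equilibrium_stop_ge_step P_markov
  (delta_discount Player1) (f0 _) (g0 _) (h0 _) eqS (hg _).
have wait1 := equilibrium_wait_le P_markov
  (delta_discount Player1) (f0 _) (g0 _) (h0 _) eqS (hg _).
have stop2 := equilibrium_stop_ge_step P_markov
  (delta_discount Player2) (f0 _) (g0 _) (h0 _) eqT (hg _).
have stop2_two := equilibrium_stop_ge_two_steps P_markov
  (delta_discount Player2) (f0 _) (g0 _) (h0 _) eqT (hg _).
have wait2 := equilibrium_wait_le P_markov
  (delta_discount Player2) (f0 _) (g0 _) (h0 _) eqT (hg _).
(* Player 2 cannot let [c] pass when nobody stops there. *)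
have cTS : (T `|` S) c.
  have [Sc|Sc] := pselect (S c); first by right.
  left; apply: contrapT => Tc.
  have g2_le x : g Player2 x <= M ^+ 2 + 1.
    by case: (abcP x) => ->; rewrite ?g2a ?g2b ?g2c; nra.
  have : f Player2 c <= delta Player2 1%N * (M ^+ 2 + 1).
    apply: wait2 => //; first by nra.
    apply: aeW => w _; split => [t _ _|_ t _]; first split => _.
    - by apply: le_trans (g2_le (w t)); apply: ltW; exact: (fg _ _).2.
    - exact: g2_le.
    - by apply: le_trans (g2_le (w t)); exact: ltW.
  rewrite f2c; nra.
have [fc gc] : (T c -> M ^+ 2 <= f Player2 c) /\ (S c -> M ^+ 2 <= g Player2 c).
  by split => _; rewrite ?f2c ?g2c//; nra.
(* Stopping at [b] pays Player 2 only [1], and [c] is one move away. *)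
have Tb : ~ T b.
  move=> Tb; have := stop2 b c _ Tb _ cTS fc gc; rewrite f2b => /(_ ltac:(nra)); nra.
have Ta : ~ T a.
  move=> Ta; have Sb : ~ S b.
    move=> Sb; have : delta Player1 1%N * M ^+ 2 * trans_prob P b a <= f Player1 b.
      apply: stop1 => //; [nra|by right|by move=> /disjoint|by rewrite g1a].
    rewrite f1b; nra.
  (* Nobody stops at [b], so Player 2 reaches [c] through [b]; it does not matter
     who stops at [c]. *)
  have := stop2_two a b c _ Ta _ _ cTS fc gc; rewrite f2a => /(_ ltac:(nra)).
  have TSb : ~ (T `|` S) b by case.
  move=> /(_ TSb); nra.
(* If nobody stopped at [b], the rewards left to Player 1 would be [f] and [g] at
   [c] and [f] at [a], all at most [2].  The reward [h] of endless play is of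
   order [M ^+ 2] at [a], so it has to be excluded almost surely. *)
have Sb : S b.
  apply: contrapT => Sb.
  have hit_c : {ae P b, forall w, exists2 t, (0 < t)%N & w t = c}.
    pose q := Num.min (trans_prob P a b) (Num.min (trans_prob P b b) (trans_prob P c b)).
    apply: (@ae_hits _ _ _ P_markov _ b b c (q * trans_prob P b c)).
    - apply: (@sub_finite_set _ _ [set` [:: a; b; c]]); last exact: finite_seq.
      by move=> x _; exact: abc_all.
    - by rewrite mulr_gt0// !lt_min p_ab p_bb p_cb.
    - move=> v; rewrite ler_wpM2r ?trans_prob_ge0//.
      by case: (abcP v) => ->; rewrite /q !ge_min lexx ?orbT.
  have : f Player1 b <= delta Player1 1%N * 2.
    apply: wait1 => //; apply: filterS hit_c => w [k k0 wk] wb.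
    split => [t _ _|never]; last first.
      by case: (never k k0); rewrite wk; case: cTS; [right|left].
    case: (abcP (w t)) => ->; split => // _; rewrite ?f1a ?f1c ?g1c; lra.
  have d1_lt1 := discount1_lt1 (delta_discount Player1).
  rewrite f1b; lra.
have stop1_b x : S x -> delta Player1 1%N * M * trans_prob P x b <= f Player1 x.
  move=> Sx; apply: stop1 => //; [lra|by left|by rewrite f1b].
have Sa : ~ S a by move=> /stop1_b; rewrite f1a; nra.
have Sc : ~ S c by move=> /stop1_b; rewrite f1c; nra.
(* Only [b] and [c] are stopping states now.  Until it stops, a path from [a] stays
   at [a], where even [h] is below [M + 1], and it can only leave [a] for [b]. *)
have : f Player2 a <= delta Player2 1%N * (M + 1).
  apply: wait2 => //; first by lra.
  have p_ac0 : trans_prob P a c = 0 by rewrite /trans_prob P_ac.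
  apply: filterS (ae_no_exit_to P_markov p_ac0) => w no_exit wa.
  have at_a t : (forall s, (0 < s <= t)%N -> ~ (T `|` S) (w s)) ->
      forall s, (s <= t)%N -> w s = a.
    move=> away [//|s] st; case: (abcP (w s.+1)) => // ws.
      by case: (away s.+1); [|right; rewrite ws].
    by case: (away s.+1) => //; rewrite ws.
  split => [[//|t] _ before|never t t0].
    have wa_le := at_a t before.
    have wc := no_exit t wa_le.
    case: (abcP (w t.+1)) => wt; rewrite wt; split => // _.
    by rewrite g2b; lra.
  have -> : w t = a by apply: (at_a t) => // s /andP[/never].
  by rewrite -g2a ltW.
rewrite f2a; nra.
Qed.
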